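(* For every constant $C$ there exist positive integers $n,k$ and a map $z:[n]\to[k]$ such that every simple-graph Markov basis for $A_{n,z}$ contains an element $\gamma$ with $\|\gamma\|_1>C$.
   Context: Coordinates of $\mathbb Z^{\binom n2}$ are indexed by 2-subsets $\{u,v\}$ of $[n]$. $D_n$ is the $n\times\binom n2$ vertex-edge incidence matrix of $K_n$; $C_z$ is the $\binom{k+1}2\times\binom n2$ matrix with rows indexed by pairs $(i,j)$, $1\le i\le j\le k$, whose column $\{u,v\}$ has a single $1$ in row $(\min(z(u),z(v)),\max(z(u),z(v)))$ and zeros elsewhere; $A_{n,z}$ is $D_n$ stacked on $C_z$. A vector $\gamma\in\{0,1\}^{\binom n2}$ is identified with the simple graph on $[n]$ with edge set $\{\{u,v\}:\gamma_{uv}=1\}$, and $A_{n,z}\gamma=(d;c)$ records its degree sequence $d$ and, for each color pair $i\le j$, the number $c(i,j)$ of edges joining a vertex of color $i$ with a vertex of color $j$. For a vector $(d;c)\in\mathbb N^{n+\binom{k+1}2}$ which equals $A_{n,z}\gamma$ for some $\gamma\in\{0,1\}^{\binom n2}$, the simple fiber is $\widetilde{\mathcal F}(d;c)=\{\gamma\in\{0,1\}^{\binom n2}:A_{n,z}\gamma=(d;c)\}$. A set $\mathcal B\subset\ker_{\mathbb Z}A_{n,z}$ is a simple-graph Markov basis for $A_{n,z}$ if for every such $(d;c)$ the graph on $\widetilde{\mathcal F}(d;c)$, with $\gamma,\gamma'$ adjacent iff $\gamma-\gamma'\in\mathcal B\cup(-\mathcal B)$, is connected. *)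

(* Defs.v *)
From mathcomp Require Import all_boot all_order all_algebra.
From mathcomp Require Import boolp classical_sets reals.
From Stdlib Require Import Relation_Operators.

Set Implicit Arguments.
Unset Strict Implicit.
Unset Printing Implicit Defensive.

Import Order.TTheory GRing.Theory Num.Theory.
Local Open Scope ring_scope.

Definition edge (n : nat) := {e : {set 'I_n} | #|e| == 2%N}.

(* Vectors with coordinates indexed by 2-subsets are column vectors of length
   #|edge n| = 'C(n, 2); coordinate a stands for the 2-subset enum_val a. *)
Definition edgevec (n : nat) := 'cV[int]_#|{: edge n}|.

Definition colorpair (k : nat) := {p : 'I_k * 'I_k | (p.1 <= p.2)%N}.

Definition edge_ends (n : nat) (a : 'I_#|{: edge n}|) : {set 'I_n} :=
  val (enum_val a : edge n).

Definition color_ends (k : nat) (r : 'I_#|{: colorpair k}|) : 'I_k * 'I_k :=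
  val (enum_val r : colorpair k).

Definition incidence_mx (n : nat) : 'M[int]_(n, #|{: edge n}|) :=
  \matrix_(v, a) (v \in edge_ends a)%:R.

Definition color_mx (n k : nat) (z : 'I_n -> 'I_k) :
    'M[int]_(#|{: colorpair k}|, #|{: edge n}|) :=
  \matrix_(r, a)
    [exists u, exists v, (edge_ends a == [set u; v]) &&
       (color_ends r == (Order.min (z u) (z v), Order.max (z u) (z v)))]%:R.

Definition config_mx (n k : nat) (z : 'I_n -> 'I_k) :
    'M[int]_(n + #|{: colorpair k}|, #|{: edge n}|) :=
  col_mx (incidence_mx n) (color_mx z).

Definition zero_one (n : nat) : set (edgevec n) :=
  [set g | forall a, g a 0 = 0 \/ g a 0 = 1]%classic.

Definition simple_fiber (n k : nat) (z : 'I_n -> 'I_k)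
    (d : 'cV[nat]_n) (c : 'cV[nat]_#|{: colorpair k}|) : set (edgevec n) :=
  [set g | zero_one g /\ config_mx z *m g = map_mx Posz (col_mx d c)]%classic.

Definition fiber_adj (n : nat) (F B : set (edgevec n)) (g g' : edgevec n) : Prop :=
  [/\ F g, F g' & B (g - g') \/ B (- (g - g'))].

Definition fiber_connected (n : nat) (F B : set (edgevec n)) : Prop :=
  forall g g', F g -> F g' -> clos_refl_trans (edgevec n) (fiber_adj F B) g g'.

Definition simple_markov_basis (n k : nat) (z : 'I_n -> 'I_k)
    (B : set (edgevec n)) : Prop :=
  (B `<=` [set g | config_mx z *m g = 0])%classic /\
  forall (d : 'cV[nat]_n) (c : 'cV[nat]_#|{: colorpair k}|),
    (simple_fiber z d c !=set0)%classic ->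
    fiber_connected (simple_fiber z d c) B.

Definition norm1 (n : nat) (g : edgevec n) : nat := (\sum_a `|g a 0%R|)%N.

(* Main.v *)
(* Take m >= 3 color classes {a_i, b_i}, i in Z/m, and let G1 have the edges
   a_i a_(i+1) and a_(i+1) b_i, while G2 has the edges a_i a_(i+1) and
   a_i b_(i+1); both lie in the same fiber.  For g in this fiber put
   x_i = g(a_i b_(i+1)).  The degree of a_(i+1) minus the numbers of edges
   between color i+1 and all colors j <> i+2 equals
     g(a_(i+1) a_(i+2)) + g(a_(i+1) b_(i+2)) - sum of the g(b_(i+1) w),
   w ranging over the vertices of colors other than i+1 and i+2.  It is
   constant on the fiber and equals 1 at G1, whence 1 <= 1 + x_(i+1) - x_i.
   Going around the cycle, all the x_i are equal.  They are 0 for G1 and 1 for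
   G2, so a path from G1 to G2 has a step at which all m of them change. *)
Require Import Defs.
From mathcomp Require Import all_boot all_order all_algebra.
From mathcomp Require Import boolp classical_sets reals.
From mathcomp Require Import zify.
From Stdlib Require Import Relation_Operators.
Import Order.TTheory GRing.Theory Num.Theory.
Local Open Scope ring_scope.

(** * Edges as 2-subsets and entries of the color matrix *)

Lemma eq_set2 (T : finType) (u v x y : T) :
  ([set u; v] == [set x; y]) = (u == x) && (v == y) || (u == y) && (v == x).
Proof.
apply/eqP/orP => [E | [] /andP[/eqP-> /eqP->] //]; last by rewrite finset.setUC.
have : u \in [set x; y] by rewrite -E set21.
have : v \in [set x; y] by rewrite -E set22.
have : x \in [set u; v] by rewrite E set21.
have : y \in [set u; v] by rewrite E set22.
rewrite !in_set2 ![x == _]eq_sym ![y == _]eq_sym.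
by case: (u == x); case: (u == y); case: (v == x); case: (v == y) => //=; auto.
Qed.

Lemma edge_endsP {n : nat} (a : 'I_#|{: edge n}|) :
  exists u v, u != v /\ edge_ends a = [set u; v].
Proof.
have /cards2P[u [v [uv E]]] := valP (enum_val a : edge n).
by exists u, v.
Qed.

Lemma edge_ends_inj {n : nat} : injective (@edge_ends n).
Proof. by move=> a b /val_inj/enum_val_inj. Qed.

Lemma edge_ends_surj {n : nat} (u v : 'I_n) :
  u != v -> exists a, edge_ends a = [set u; v].
Proof.
move=> uv; have h : #|[set u; v]| == 2%N by rewrite cards2 uv.
exists (enum_rank (exist _ [set u; v] h : edge n)).
by rewrite /edge_ends enum_rankK.
Qed.

Lemma color_mxE {n k : nat} (z : 'I_n -> 'I_k) r a u v :
  edge_ends a = [set u; v] ->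
  color_mx z r a =
    (color_ends r == (Order.min (z u) (z v), Order.max (z u) (z v)))%:R.
Proof.
move=> Ea; rewrite mxE Ea; congr (nat_of_bool _)%:R; apply/existsP/idP.
  case=> u' /existsP[v' /andP[]]; rewrite eq_set2.
  by case/orP=> /andP[/eqP-> /eqP->] //; rewrite minC maxC.
by move=> h; exists u; apply/existsP; exists v; rewrite eqxx h.
Qed.

(** Column [a] has its single 1 in the row of the sorted pair of colors of [u] and [v]; the symmetry
    of [P] undoes the sorting. *)
Lemma sum_color_mx {n k : nat} (z : 'I_n -> 'I_k) (P : rel 'I_k) a u v :
  symmetric P -> edge_ends a = [set u; v] ->
  \sum_(r | P (color_ends r).1 (color_ends r).2) color_mx z r a
    = (P (z u) (z v))%:R.
Proof.
move=> Psym Ea; set p := (Order.min (z u) (z v), Order.max (z u) (z v)).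
have hp : (p.1 <= p.2)%N.
  rewrite /p /=; case: (leP (z u) (z v)) => //.
  by move/ltW.
pose r0 := enum_rank (exist _ p hp : colorpair k).
have Er0 : color_ends r0 = p by rewrite /color_ends enum_rankK.
have Er r : (color_ends r == p) = (r == r0).
  apply/eqP/eqP => [h | ->//]; apply/enum_val_inj/val_inj.
  by rewrite -/(color_ends r) h -Er0.
have PE : P p.1 p.2 = P (z u) (z v).
  by rewrite /p /=; case: (leP (z u) (z v)) => //; rewrite Psym.
under eq_bigr => r _ do rewrite (color_mxE _ _ _ _ _ Ea) Er.
rewrite -PE -Er0.
case h : (P (color_ends r0).1 (color_ends r0).2).
  rewrite (bigD1 r0) //= eqxx big1 ?addr0 // => r /andP[_ /negPf->] //.
by apply: big1 => r hr; case: eqP => // e; rewrite -e hr in h.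
Qed.

(** * Indicator vectors of edges and single coordinates *)

Definition edge_unit {n : nat} (u v : 'I_n) : edgevec n :=
  \col_a (edge_ends a == [set u; v])%:R.

(** The sum form requires no proof of [u != v]; for [u = v] the value is 0, since no edge is a
    singleton. *)
Definition edge_at {n : nat} (g : edgevec n) (u v : 'I_n) : int :=
  \sum_a (edge_ends a == [set u; v])%:R * g a 0.

Lemma sum_edge_ends {n : nat} (F : 'I_#|{: edge n}| -> int) a u v :
  edge_ends a = [set u; v] ->
  \sum_b (edge_ends b == [set u; v])%:R * F b = F a.
Proof.
move=> Ea; rewrite (bigD1 a) //= Ea eqxx mul1r big1 ?addr0 // => b ba.
by rewrite -Ea (inj_eq edge_ends_inj) (negPf ba) mul0r.
Qed.

Lemma mul_edge_unit {n p : nat} (M : 'M[int]_(p, _)) a (u v : 'I_n) i :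
  edge_ends a = [set u; v] -> (M *m edge_unit u v) i 0 = M i a.
Proof.
move=> Ea; rewrite mxE -(sum_edge_ends (M i) _ _ _ Ea).
by apply: eq_bigr => b _; rewrite mxE mulrC.
Qed.

Lemma edge_unit_sumE {n : nat} (I : finType) (f f' : I -> 'I_n) a :
  (\sum_x edge_unit (f x) (f' x)) a 0 =
    \sum_x (edge_ends a == [set f x; f' x])%:R.
Proof. by rewrite summxE; apply: eq_bigr => x _; rewrite mxE. Qed.

(** Injectivity ensures that no edge is added twice. *)
Lemma zero_one_edge_units {n : nat} (I : finType) (f f' : I -> 'I_n) :
  injective (fun x => [set f x; f' x]) ->
  zero_one (\sum_x edge_unit (f x) (f' x)).
Proof.
move=> inj a; rewrite edge_unit_sumE.
have [[x /eqP Ex]|no] := pselect (exists x, edge_ends a == [set f x; f' x]).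
  right; rewrite (bigD1 x) //= Ex eqxx big1 ?addr0 // => y yx.
  by rewrite (inj_eq inj) eq_sym (negPf yx).
left; apply: big1 => x _; case: eqP => // E; case: no; exists x; exact/eqP.
Qed.

Lemma edge_at_units {n : nat} (I : finType) (f f' : I -> 'I_n) u v :
  u != v -> edge_at (\sum_x edge_unit (f x) (f' x)) u v =
    \sum_x ([set u; v] == [set f x; f' x])%:R.
Proof.
case/edge_ends_surj=> a Ea.
by rewrite /edge_at (sum_edge_ends (fun a => _ a 0) _ _ _ Ea) edge_unit_sumE Ea.
Qed.

Lemma edge_atB {n : nat} (g h : edgevec n) u v :
  edge_at (g - h) u v = edge_at g u v - edge_at h u v.
Proof.
rewrite /edge_at -sumrB; apply: eq_bigr => a _.
by rewrite !mxE mulrBr.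
Qed.

Lemma edge_at_zero_one {n : nat} (g : edgevec n) u v :
  u != v -> zero_one g -> edge_at g u v = 0 \/ edge_at g u v = 1.
Proof.
case/edge_ends_surj=> a Ea; rewrite /edge_at.
by rewrite (sum_edge_ends (fun a => g a 0) _ _ _ Ea).
Qed.

(** Distinct pairs select distinct coordinates, and a nonzero integer coordinate contributes at
    least 1 to the norm. *)
Lemma norm1_ge_card {n : nat} (I : finType) (f f' : I -> 'I_n) (g : edgevec n) :
  (forall x, f x != f' x) -> injective (fun x => [set f x; f' x]) ->
  (forall x, edge_at g (f x) (f' x) != 0) -> (#|I| <= norm1 g)%N.
Proof.
move=> ne inj g0; pose h x := projT1 (cid (edge_ends_surj _ _ (ne x))).
have Eh x : edge_ends (h x) = [set f x; f' x].
  exact: projT2 (cid (edge_ends_surj _ _ (ne x))).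
have hinj : injective h by move=> x y e; apply: inj; rewrite /= -!Eh e.
have gh x : (0 < `|g (h x) 0%R|)%N.
  have := g0 x; rewrite /edge_at (sum_edge_ends (fun a => g a 0) _ _ _ (Eh x)).
  by rewrite absz_gt0.
rewrite /norm1 (bigID (mem (h @: I))) /= (leq_trans _ (leq_addr _ _)) //.
rewrite big_imset /=; last by move=> x y _ _; exact: hinj.
by rewrite -sum1_card leq_sum.
Qed.

Lemma norm1N {n : nat} (g : edgevec n) : norm1 (- g) = norm1 g.
Proof. by apply: eq_bigr => a _; rewrite mxE abszN. Qed.

(** If [f] differs at the ends of a concatenation of two paths, it differs at the ends of one of
    them. *)
Lemma clos_refl_trans_step (A : Type) (B : eqType) (R : A -> A -> Prop)
    (f : A -> B) x y :
  clos_refl_trans A R x y -> f x != f y -> exists x' y', R x' y' /\ f x' != f y'.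
Proof.
elim=> {x y} [x y xy fxy|x|x y z _ IHx _ IHy fxz].
- by exists x, y.
- by rewrite eqxx.
- case: (eqVneq (f x) (f y)) => [e|/IHx//]; apply: IHy.
  by rewrite -e.
Qed.

(** * Two vertices for each color of a cycle of length [p.+3] *)

(* [node i true] is a_i and [node i false] is b_i. *)
Definition node {p : nat} (i : 'I_p.+3) (s : bool) : 'I_#|{: 'I_p.+3 * bool}| :=
  enum_rank (i, s).

Definition node_color (p : nat) (v : 'I_#|{: 'I_p.+3 * bool}|) : 'I_p.+3 :=
  (enum_val v).1.

Lemma node_eq {p : nat} (i j : 'I_p.+3) s t :
  (node i s == node j t) = (i == j) && (s == t).
Proof. by rewrite (inj_eq enum_rank_inj) xpair_eqE. Qed.

Lemma nodeP {p : nat} (v : 'I_#|{: 'I_p.+3 * bool}|) : exists i s, v = node i s.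
Proof.
exists (enum_val v).1, (enum_val v).2.
by rewrite /node -surjective_pairing enum_valK.
Qed.

Lemma node_colorE {p : nat} (i : 'I_p.+3) s : node_color p (node i s) = i.
Proof. by rewrite /node_color enum_rankK. Qed.

(** This is where m >= 3 enters: with two colors, [i + 1 + 1] would be [i]. *)
Lemma succ_neq {p : nat} (i : 'I_p.+3) :
  ((i + 1 == i) = false) * ((i == i + 1) = false) *
  (((i + 1 + 1 == i) = false) * ((i == i + 1 + 1) = false)).
Proof.
have E (c : 'I_p.+3) : (i + c == i) = (c == 0).
  by rewrite -[X in _ == X]addr0 (inj_eq (addrI i)).
by rewrite ![i == _]eq_sym -addrA !E oner_eq0.
Qed.

(** * The two graphs and their common fiber *)

Definition graph1 (p : nat) : edgevec #|{: 'I_p.+3 * bool}| :=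
  \sum_(x : 'I_p.+3 * bool) edge_unit (node (x.1 + 1) true) (node x.1 x.2).

Definition graph2 (p : nat) : edgevec #|{: 'I_p.+3 * bool}| :=
  \sum_(x : 'I_p.+3 * bool) edge_unit (node x.1 true) (node (x.1 + 1) x.2).

Definition nodeE := (@node_eq, @node_colorE, @succ_neq).

Lemma zero_one_graph1 (p : nat) : zero_one (graph1 p).
Proof.
apply: zero_one_edge_units => -[i s] [j t] /= /eqP.
rewrite eq_set2 !nodeE (inj_eq (addIr 1)) /=.
case/orP=> /andP[/andP[/eqP e h] /andP[/eqP e' h']].
  by rewrite e (eqP h').
(* Matching the endpoints crosswise would give [j + 1 + 1 = j]. *)
by move/eqP: e; rewrite e' succ_neq.
Qed.

Lemma zero_one_graph2 (p : nat) : zero_one (graph2 p).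
Proof.
apply: zero_one_edge_units => -[i s] [j t] /= /eqP.
rewrite eq_set2 !nodeE (inj_eq (addIr 1)) /=.
case/orP=> /andP[/andP[/eqP e h] /andP[/eqP e' h']].
  by rewrite e (eqP h').
by move/eqP: e'; rewrite e succ_neq.
Qed.

Lemma edge_at_graph1 (p : nat) (i : 'I_p.+3) :
  edge_at (graph1 p) (node i true) (node (i + 1) false) = 0.
Proof.
rewrite edge_at_units ?nodeE ?andbF //.
apply: big1 => -[j s] _ /=; rewrite eq_set2 !nodeE !andbF orbF /=.
by case: eqP => [->|] //=; rewrite succ_neq.
Qed.

Lemma edge_at_graph2 (p : nat) (i : 'I_p.+3) :
  edge_at (graph2 p) (node i true) (node (i + 1) false) = 1.
Proof.
rewrite edge_at_units ?nodeE ?andbF //.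
rewrite (bigD1 (i, false)) //= eqxx big1 ?addr0 // => -[j s].
rewrite xpair_eqE eq_set2 !nodeE (inj_eq (addIr 1)) !andbF orbF /= andbT.
by rewrite eq_sym; case: (i == j) => //=; case: s.
Qed.

Lemma sum_rot (p : nat) (F : 'I_p.+3 -> bool -> int) :
  \sum_(x : 'I_p.+3 * bool) F (x.1 + 1) x.2 = \sum_(x : 'I_p.+3 * bool) F x.1 x.2.
Proof.
symmetry; apply: (reindex (fun x : 'I_p.+3 * bool => (x.1 + 1, x.2))).
exists (fun x => (x.1 - 1, x.2)) => -[i s] _ /=; by rewrite ?addrK ?subrK.
Qed.

Lemma incidence_edge_unit {n : nat} (u v w : 'I_n) : u != v ->
  (incidence_mx n *m edge_unit u v) w 0 = (w == u)%:R + (w == v)%:R.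
Proof.
move=> uv; have [a Ea] := edge_ends_surj _ _ uv.
rewrite (mul_edge_unit _ _ _ _ _ Ea) mxE Ea in_set2 -natrD; congr _%:R.
by case: eqP => // ->; rewrite (negPf uv).
Qed.

Lemma color_edge_unit {n k : nat} (z : 'I_n -> 'I_k) (u v : 'I_n) r : u != v ->
  (color_mx z *m edge_unit u v) r 0 =
    (color_ends r == (Order.min (z u) (z v), Order.max (z u) (z v)))%:R.
Proof.
move=> uv; have [a Ea] := edge_ends_surj _ _ uv.
by rewrite (mul_edge_unit _ _ _ _ _ Ea) (color_mxE _ _ _ _ _ Ea).
Qed.

(** For each index [x] the two graphs have an edge between the same two colors, so the color counts
    agree term by term. The degrees agree only after summation: each sum over endpoints is rotated
    by one color. *)
Lemma config_graph12 (p : nat) :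
  config_mx (node_color p) *m graph1 p = config_mx (node_color p) *m graph2 p.
Proof.
have ne (x : 'I_p.+3 * bool) : node x.1 true != node (x.1 + 1) x.2.
  by rewrite eq_sym !nodeE.
rewrite /config_mx !mul_col_mx; congr col_mx; apply/colP => w.
- rewrite /graph1 /graph2 !mulmx_sumr !summxE.
  under eq_bigr => x _ do rewrite incidence_edge_unit ?nodeE //.
  under [RHS]eq_bigr => x _ do rewrite incidence_edge_unit //.
  rewrite !big_split /= (sum_rot p (fun i s => (w == node i true)%:R)).
  by rewrite (sum_rot p (fun i s => (w == node i s)%:R)).
- rewrite /graph1 /graph2 !mulmx_sumr !summxE; apply: eq_bigr => x _.
  by rewrite !color_edge_unit ?ne ?nodeE // minC maxC.
Qed.

(** * Linear forms constant on the fiber, and the cyclic inequality *)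

(* The color pairs whose edge counts the header subtracts from the degree. *)
Definition counted_colors {p : nat} (i : 'I_p.+3) : rel 'I_p.+3 :=
  [rel x y | ((x == i + 1) || (y == i + 1)) &&
             (x != i + 1 + 1) && (y != i + 1 + 1)].

(** The coefficient at [a] of the linear form described in the header, written as a combination of
    matrix rows to make its invariance on fibers immediate. *)
Definition weight {p : nat} (i : 'I_p.+3) a : int :=
  incidence_mx _ (node (i + 1) true) a -
  \sum_(r | counted_colors i (color_ends r).1 (color_ends r).2)
     color_mx (node_color p) r a.

Lemma weightE {p : nat} (i : 'I_p.+3) a u v : edge_ends a = [set u; v] ->
  weight i a = ((node (i + 1) true == u) || (node (i + 1) true == v))%:R
             - (counted_colors i (node_color p u) (node_color p v))%:R.
Proof.
move=> Ea; rewrite /weight (sum_color_mx _ _ _ _ _ _ Ea) ?mxE ?Ea ?in_set2 //.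
move=> x y; rewrite /counted_colors /= orbC -!andbA; congr (_ && _); exact: andbC.
Qed.

Lemma weight_config {p : nat} (i : 'I_p.+3) (g h : edgevec _) :
  config_mx (node_color p) *m g = config_mx (node_color p) *m h ->
  \sum_a weight i a * g a 0 = \sum_a weight i a * h a 0.
Proof.
have E (f : edgevec _) : \sum_a weight i a * f a 0 =
    (incidence_mx _ *m f) (node (i + 1) true) 0 -
    \sum_(r | counted_colors i (color_ends r).1 (color_ends r).2)
       (color_mx (node_color p) *m f) r 0.
  under [in RHS]eq_bigr => r _ do rewrite mxE.
  rewrite exchange_big /= mxE -sumrB; apply: eq_bigr => a _.
  by rewrite mulrBl mulr_suml.
by rewrite /config_mx !mul_col_mx !E => /eq_col_mx[-> ->].
Qed.

(** On edges between colors i and i+1 the degree term and the color term cancel or both vanish.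
    Among the edges to color i+2, only the one from a_(i+1) to a_(i+2) has a nonzero weight, namely
    1. *)
Lemma weight_graph1 {p : nat} (i : 'I_p.+3) :
  \sum_a weight i a * graph1 p a 0 = 1.
Proof.
under eq_bigr => a _ do rewrite edge_unit_sumE mulr_sumr.
rewrite exchange_big /=.
have E (x : 'I_p.+3 * bool) : \sum_a weight i a *
    (edge_ends a == [set node (x.1 + 1) true; node x.1 x.2])%:R
    = (x == (i + 1, true))%:R.
  case: x => j s /=.
  have /edge_ends_surj[a Ea] : node (j + 1) true != node j s by rewrite !nodeE.
  under eq_bigr => a' _ do rewrite mulrC.
  rewrite (sum_edge_ends (weight i) _ _ _ Ea) (weightE _ _ _ _ Ea) /= !nodeE.
  rewrite {a Ea}/counted_colors xpair_eqE /= !(inj_eq (addIr 1)).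
  rewrite [i + 1 == j]eq_sym [i == j]eq_sym.
  case: (eqVneq j i) => [->|_] /=; first by rewrite ?eqxx !succ_neq.
  case: (eqVneq j (i + 1)) => [->|_] /=; last by rewrite subrr.
  by rewrite subr0 eq_sym.
under eq_bigr => x _ do rewrite E.
by rewrite (bigD1 (i + 1, true)) //= eqxx big1 ?addr0 // => x /negPf->.
Qed.

(** The weight is 1 on the two edges from a_(i+1) to color i+2, -1 on the edges from b_(i+1) to
    colors other than i+1 and i+2, and 0 elsewhere. Of the negative terms the bound keeps only the
    one at a_i b_(i+1). *)
Lemma weight_le {p : nat} (i : 'I_p.+3) a :
  weight i a <=
    (edge_ends a == [set node (i + 1) true; node (i + 1 + 1) true])%:R +
    (edge_ends a == [set node (i + 1) true; node (i + 1 + 1) false])%:R -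
    (edge_ends a == [set node i true; node (i + 1) false])%:R.
Proof.
have [u [v [uv Ea]]] := edge_endsP a.
rewrite (weightE _ _ _ _ Ea) Ea !eq_set2.
have [j [s Eu]] := nodeP u; have [l [t Ev]] := nodeP v.
move: uv; rewrite Eu Ev {u v Ea Eu Ev} !node_eq !node_colorE /counted_colors /=.
(* The cases locate the colors of both endpoints relative to i, i+1 and i+2. *)
rewrite ![i + 1 == _]eq_sym.
case: (eqVneq j i) => [->|_]; [|case: (eqVneq j (i + 1)) => [->|_];
  [|case: (eqVneq j (i + 1 + 1)) => [->|_]]];
case: (eqVneq l i) => [->|_]; try (case: (eqVneq l (i + 1)) => [->|_];
  try case: (eqVneq l (i + 1 + 1)) => [->|_]);
by rewrite ?eqxx ?succ_neq /=; case: s; case: t => //=; case: (l == _).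
Qed.

(** Summing [weight_le] against the nonnegative entries of [g] gives 1 <= g(a_(i+1) a_(i+2)) +
    x_(i+1) - x_i, where the first summand is at most 1. *)
Lemma edge_at_succ {p : nat} (i : 'I_p.+3) (g : edgevec _) :
  zero_one g ->
  config_mx (node_color p) *m g = config_mx (node_color p) *m graph1 p ->
  edge_at g (node i true) (node (i + 1) false) <=
  edge_at g (node (i + 1) true) (node (i + 1 + 1) false).
Proof.
move=> g01 Eg; have := weight_config i _ _ Eg; rewrite weight_graph1 => W.
have : \sum_a weight i a * g a 0 <=
    edge_at g (node (i + 1) true) (node (i + 1 + 1) true) +
    edge_at g (node (i + 1) true) (node (i + 1 + 1) false) -
    edge_at g (node i true) (node (i + 1) false).
  rewrite /edge_at -big_split /= -sumrB; apply: ler_sum => a _.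
  rewrite -mulrDl -mulrBl ler_wpM2r ?weight_le //.
  by case: (g01 a) => ->.
have ne : node (i + 1) true != node (i + 1 + 1) true.
  by rewrite eq_sym !nodeE.
rewrite W; case: (edge_at_zero_one _ _ _ ne g01) => ->; lia.
Qed.

(** A function that never decreases from one element of a finite cycle to the next is constant. *)
Lemma edge_at_const {p : nat} (i j : 'I_p.+3) (g : edgevec _) :
  zero_one g ->
  config_mx (node_color p) *m g = config_mx (node_color p) *m graph1 p ->
  edge_at g (node i true) (node (i + 1) false) =
  edge_at g (node j true) (node (j + 1) false).
Proof.
move=> g01 Eg; pose x i := edge_at g (node i true) (node (i + 1) false).
have mono k (l : 'I_p.+3) : x l <= x (l + k%:R).
  elim: k => [|k IH]; first by rewrite addr0.
  by rewrite -natr1 addrA (le_trans IH) // edge_at_succ.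
have le k l : x k <= x l.
  (* The residue [l - k], read as a natural number, is the number of unit steps from [k] to [l]. *)
  by have := mono (l - k : 'I_p.+3) k; rewrite natr_Zp addrC subrK.
by apply/eqP; rewrite eq_le !le.
Qed.

(** * A long move on every path between the two graphs *)

Theorem theorem1p2 (R : realType) (C : R) :
  exists (n k : nat) (z : 'I_n -> 'I_k),
    [/\ (0 < n)%N, (0 < k)%N &
        forall B : set (edgevec n), simple_markov_basis z B ->
          exists2 g : edgevec n, B g & C < (norm1 g)%:R].
Proof.
(* This makes [p] exceed [C]; the three further colors keep the cycle long enough even for small
   [p]. *)
pose p := Num.bound `|C|.
exists #|{: 'I_p.+3 * bool}|, p.+3, (node_color p); split => //.
  by rewrite card_prod card_ord card_bool muln_gt0.
move=> B [_ conn].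
pose M := config_mx (node_color p) *m graph1 p.
(* Fibers are indexed by natural vectors, so nonnegativity is needed to recover [M] from its
   absolute values [N]. *)
have M_ge0 r : 0 <= M r 0.
  rewrite mxE sumr_ge0 // => a _; apply: mulr_ge0; last first.
    by case: (zero_one_graph1 p a) => ->.
  by rewrite /config_mx mxE; case: split => r'; rewrite mxE.
pose N := map_mx absz M.
have EN : map_mx Posz (col_mx (usubmx N) (dsubmx N)) = M.
  by rewrite vsubmxK; apply/colP => r; rewrite mxE [N _ _]mxE gez0_abs.
have F1 : simple_fiber (node_color p) (usubmx N) (dsubmx N) (graph1 p).
  by split; [exact: zero_one_graph1 | rewrite EN].
have F2 : simple_fiber (node_color p) (usubmx N) (dsubmx N) (graph2 p).
  by split; [exact: zero_one_graph2 | rewrite EN -config_graph12].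
have path12 := conn _ _ (ex_intro _ _ F1) _ _ F1 F2.
(* One coordinate detects the step; [edge_at_const] at both of its ends spreads the change to all
   [p.+3] edges a_i b_(i+1). *)
pose x g := edge_at g (node (0 : 'I_p.+3) true) (node (0 + 1) false).
have [|g [g' [[[g01 Eg] [g'01 Eg'] Bgg'] ne]]] :=
    clos_refl_trans_step _ _ _ x _ _ path12.
  by rewrite /x edge_at_graph1 edge_at_graph2.
rewrite EN in Eg; rewrite EN in Eg'.
have big : C < (norm1 (g - g'))%:R.
  have card : (p.+3 <= norm1 (g - g')%R)%N.
    rewrite -[X in (X <= _)%N]card_ord.
    apply: (norm1_ge_card _ (fun i => node i true) (fun i => node (i + 1) false)).
    - by move=> i; rewrite !nodeE andbF.
    - move=> i j /= /eqP; rewrite eq_set2 !nodeE !andbF orbF !andbT.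
      by case/andP=> /eqP.
    - move=> i; rewrite edge_atB subr_eq0.
      by rewrite (edge_at_const i 0) // [X in _ != X](edge_at_const i 0).
  apply: (@lt_le_trans _ _ p%:R).
    by rewrite (le_lt_trans (ler_norm C)) ?archi_boundP.
  by rewrite ler_nat (leq_trans _ card) // -addn3 leq_addr.
(* Adjacency puts the move in [B] only up to sign, which the norm ignores. *)
case: Bgg' => Bg; first by exists (g - g').
by exists (- (g - g')) => //; rewrite norm1N.
Qed.
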